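(* Let $R$ be a standard $\mathbb{N}_0^d$-graded Noetherian ring with degree $(0,\ldots,0)$ component $A$, and let $M=\bigoplus_{n\in\mathbb{Z}^d}M_n$ be a quasi-finite multigraded $R$-module. Then there exists $b\in \mathbb{Z}^d$ such that for all $n, m\in \mathbb{Z}^d$ with $b\leq n\leq m$, $\operatorname{Ass}_A(M_n) \subseteq \operatorname{Ass}_A(M_m)$. Moreover, if $\operatorname{Ass}_A (M)$ is a finite set, then there exists $k\in \mathbb{Z}^d$ such that for all $n \in \mathbb{Z}^d$ with $n\geq k$, $\operatorname{Ass}_A( M_n) = \operatorname{Ass}_A (M_k)$.
   Context: $\mathbb{N}_0$ denotes the non-negative integers; for $n,m\in\mathbb{Z}^d$, $n\geq m$ means $n_i\geq m_i$ for all $1\le i\le d$. All rings are commutative with identity. A standard $\mathbb{N}_0^d$-graded Noetherian ring $R=\bigoplus_{n\in\mathbb{N}_0^d}R_n$ is a Noetherian $\mathbb{N}_0^d$-graded ring generated as an algebra over its degree $(0,\ldots,0)$ component $A=R_{(0,\ldots,0)}$ by elements of total degree one. $R_+$ denotes the ideal of $R$ generated by $R_{(1,\ldots,1)}$. A multigraded $R$-module means a $\mathbb{Z}^d$-graded $R$-module $M=\bigoplus_{n\in\mathbb{Z}^d}M_n$ such that (i) each $M_n$ is a finitely generated $A$-module, and (ii) there exists $a\in\mathbb{Z}^d$ with $M_n=0$ for $n\leq a$. ($M$ is not assumed finitely generated over $R$.) Here $H^0_{R_+}(M)=\{x\in M: R_+^t x=0 \text{ for some } t\ge 1\}$, which is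 a graded submodule of $M$. A multigraded $R$-module $M$ is quasi-finite if there exists $b\in\mathbb{Z}^d$ such that $H^0_{R_+}(M)_n=0$ for all $n\geq b$. *)

(* Defs.v *)
From HB Require Import structures.
From mathcomp Require Import all_boot all_order all_algebra.
From mathcomp Require Import boolp classical_sets functions cardinality.

Set Implicit Arguments.
Unset Strict Implicit.
Unset Printing Implicit Defensive.

Import Order.TTheory GRing.Theory Num.Theory.

Local Open Scope classical_set_scope.
Local Open Scope ring_scope.

(* Gradings are internal: a family of subsets of the ring or module. The
   degree-zero ring A is then a subring of R, given as a set, and A-modules are
   subsets of an R-module. Rings may be trivial, hence comPzRingType.
   Degrees are functions 'I_d -> int or 'I_d -> nat, compared with the
   pointwise order (_ <= _)%O of mathcomp.classical.boolp. *)

Section Modules.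
Variables (R : comPzRingType) (A : set R).

(* The A-submodules of V when A is a subring of R. *)
Definition submodule (V : lmodType R) (N : set V) : Prop :=
  N 0 /\ forall a u v, A a -> N u -> N v -> N (a *: u + v).

Definition finitely_generated (V : lmodType R) (N : set V) : Prop :=
  exists s : seq V, N = smallest (@submodule V) [set` s].

Definition prime_ideal (P : set R) : Prop :=
  [/\ P `<=` A, @submodule R^o P, ~ P 1
    & forall a b, A a -> A b -> P (a * b) -> P a \/ P b].

Definition annihilator (V : lmodType R) (x : V) : set R :=
  [set a | A a /\ a *: x = 0].

Definition Ass (V : lmodType R) (N : set V) : set (set R) :=
  [set P | prime_ideal P /\ exists2 x, N x & P = annihilator x].

End Modules.

Section Ideals.
Variable R : comPzRingType.
Implicit Types I J X : set R.

Definition ideal I : Prop := @submodule R [set: R] R^o I.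

Definition ideal_generated X : set R := smallest ideal X.

Definition noetherian : Prop :=
  forall I, ideal I -> @finitely_generated R [set: R] R^o I.

Definition ideal_mul I J : set R :=
  ideal_generated [set a * b | a in I & b in J].

Definition ideal_exp I (t : nat) : set R := iter t (ideal_mul I) [set: R].

End Ideals.

Definition direct_sum (I : eqType) (V : zmodType) (C : I -> set V) : Prop :=
  [/\ forall i, zmod_closed (mem (C i)),
      forall v, exists s : seq I, exists x : I -> V,
        [/\ uniq s, forall i, C i (x i) & v = \sum_(i <- s) x i]
    & forall (s : seq I) (x : I -> V), uniq s -> (forall i, C i (x i)) ->
        \sum_(i <- s) x i = 0 -> forall i, i \in s -> x i = 0].

Section Gradings.
Variables (d : nat) (R : comPzRingType) (Rg : ('I_d -> nat) -> set R).

Definition graded_ring : Prop :=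
  [/\ direct_sum Rg, Rg (fun=> 0%N) 1
    & forall n m a b, Rg n a -> Rg m b -> Rg (fun i => n i + m i)%N (a * b)].

Definition degree_one : set R :=
  \bigcup_(n in [set n : 'I_d -> nat | (\sum_i n i = 1)%N]) Rg n.

Definition standard_graded_noetherian : Prop :=
  [/\ graded_ring, noetherian R
    & smallest (fun S : set R => subring_closed (mem S))
        (Rg (fun=> 0%N) `|` degree_one) = [set: R]].

Definition irrelevant : set R := ideal_generated (Rg (fun=> 1%N)).

Variables (M : lmodType R) (Mg : ('I_d -> int) -> set M).

Definition graded_module : Prop :=
  direct_sum Mg /\
  forall n m a x, Rg n a -> Mg m x -> Mg (fun i => (n i)%:Z + m i) (a *: x).

Definition multigraded_module : Prop :=
  [/\ graded_module,
      forall n, finitely_generated (Rg (fun=> 0%N)) (Mg n)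
    & exists a : 'I_d -> int,
        forall n : 'I_d -> int, (n <= a)%O -> Mg n = [set 0]].

Definition local_cohomology0 : set M :=
  [set x | exists2 t : nat, (1 <= t)%N
         & forall r, ideal_exp irrelevant t r -> r *: x = 0].

Definition quasi_finite : Prop :=
  multigraded_module /\
  exists b : 'I_d -> int, forall n : 'I_d -> int, (b <= n)%O ->
    local_cohomology0 `&` Mg n = [set 0].

End Gradings.

(* Main.v *)
(** Multiplication by a form of degree e_i cannot annihilate a nonzero element
    x of M_n for large n: every element of R_(1,...,1) is a combination of
    forms of degree e_i, so x would be killed by R_+.  If P = ann_A(x) were not
    the annihilator of any a x with a in R_(e_i), then, the ideal generated by
    R_(e_i) being finitely generated, a single c in A \ P would satisfy
    R_(e_i) c x = 0, hence c x = 0, a contradiction.  So Ass(M_n) increases with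
    n, and it is eventually constant when the union is finite. *)
Require Import Defs.
From mathcomp Require Import all_boot all_order all_algebra.
From mathcomp Require Import boolp classical_sets functions cardinality ring.

Set Implicit Arguments.
Unset Strict Implicit.
Unset Printing Implicit Defensive.

Local Open Scope classical_set_scope.
Local Open Scope ring_scope.

Import Order.TTheory GRing.Theory Num.Theory.

(** * Sums of selected homogeneous components *)

Lemma zmod_closed_memP (V : zmodType) (S : set V) :
  zmod_closed (mem S) <-> S 0 /\ forall u v, S u -> S v -> S (u - v).
Proof.
split=> [[S0 SB]|[S0 SB]]; split.
- by rewrite inE in S0.
- by move=> u v Su Sv; have := SB u v; rewrite !inE; apply.
- by rewrite inE.
- by move=> u v; rewrite !inE; apply: SB.
Qed.

Section HomogeneousSpan.
Variables (I : eqType) (V : zmodType) (C : I -> set V).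

(** The partial direct sum over the indices in [P]. As an additive closure it allows containments to
    be proved by induction on homogeneous elements, without handling explicit sums. *)
Definition homogeneous_span (P : set I) : set V :=
  smallest (fun S : set V => zmod_closed (mem S)) (\bigcup_(i in P) C i).

Lemma homogeneous_span_zmod (P : set I) :
  homogeneous_span P 0 /\
  forall u v, homogeneous_span P u -> homogeneous_span P v ->
    homogeneous_span P (u - v).
Proof.
split=> [S [/zmod_closed_memP[]] //|u v Pu Pv S SP].
have /zmod_closed_memP[_ SB] := SP.1.
by apply: SB; [apply: Pu|apply: Pv].
Qed.

Lemma homogeneous_span_sub (P : set I) (i : I) :
  P i -> C i `<=` homogeneous_span P.
Proof. by move=> Pi x Cx; apply: sub_gen_smallest; exists i. Qed.

Lemma homogeneous_span_ind (P : set I) (S : set V) :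
  S 0 -> (forall u v, S u -> S v -> S (u - v)) ->
  (forall i, P i -> C i `<=` S) -> homogeneous_span P `<=` S.
Proof.
move=> S0 SB SC; apply: smallest_sub; first by apply/zmod_closed_memP.
by move=> x [i Pi Cx]; apply: SC Pi _ Cx.
Qed.

Hypothesis dC : direct_sum C.

Lemma direct_sum_component (i : I) :
  C i 0 /\ forall u v, C i u -> C i v -> C i (u - v).
Proof. by have [zC _ _] := dC; apply/zmod_closed_memP. Qed.

(* Quantifying over every s' containing s lets two decompositions be added
   without comparing their index lists. *)
Lemma homogeneous_span_sum (P : set I) (v : V) :
  homogeneous_span P v ->
  exists s : seq I, exists x : I -> V,
    [/\ forall i, C i (x i), forall i, ~ P i -> x i = 0
      & forall s', uniq s' -> {subset s <= s'} -> v = \sum_(i <- s') x i].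
Proof.
move: v; apply: homogeneous_span_ind =>
  [|u v [s [x [Cx Px ux]]] [t [y [Cy Py vy]]]|i Pi v Cv].
- exists [::], (fun=> 0); split=> // [i|s' _ _]; last by rewrite big1.
  by have [] := direct_sum_component i.
- exists (s ++ t), (fun i => x i - y i); split.
  + by move=> i; have [_] := direct_sum_component i; apply.
  + by move=> i nPi; rewrite Px// Py// subr0.
  + move=> s' us' sub; rewrite sumrB -(ux s')// -?(vy s')// => i si; apply: sub;
      by rewrite mem_cat si ?orbT.
- exists [:: i], (fun j => if j == i then v else 0); split.
  + move=> j; case: eqP => [->//|_]; by have [] := direct_sum_component j.
  + by move=> j nPj; case: eqP => // ji; rewrite ji in nPj.
  + move=> s' us' sub; rewrite (bigD1_seq i) ?sub ?mem_head//= eqxx.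
    by rewrite big1 ?addr0// => j /negPf ->.
Qed.

(** Subtracting [v], placed in component [j], from a decomposition of [v] over [P] gives a vanishing
    sum. Its [j]-th term is [- v], and independence of the components makes it zero. *)
Lemma homogeneous_span_eq0 (P : set I) (j : I) (v : V) :
  ~ P j -> C j v -> homogeneous_span P v -> v = 0.
Proof.
move=> nPj Cv /homogeneous_span_sum[s [x [Cx Px vx]]].
have [_ _ indep] := dC.
(* The index [j] may be absent from [s]; adding it puts both decompositions on one duplicate-free
   list. *)
pose s' := undup (j :: s).
have us' : uniq s' by apply: undup_uniq.
have js' : j \in s' by rewrite mem_undup mem_head.
have sum0 : \sum_(i <- s') (x i - (if i == j then v else 0)) = 0.
  rewrite sumrB -vx//; last first.
    by move=> i si; rewrite mem_undup in_cons si orbT.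
  rewrite (bigD1_seq j)//= eqxx big1 ?addr0 ?subrr//.
  by move=> i /negPf ->.
have Cxv i : C i (x i - (if i == j then v else 0)).
  have [C0 CB] := direct_sum_component i.
  by apply: CB => //; case: eqP => // ->.
have := indep _ _ us' Cxv sum0 j js'.
by rewrite eqxx Px// sub0r => /eqP; rewrite oppr_eq0 => /eqP.
Qed.

End HomogeneousSpan.

(** * Annihilators over a Noetherian ring *)

Lemma ideal_annihilator (R : comPzRingType) (V : lmodType R) (x : V) :
  ideal [set r : R | r *: x = 0].
Proof.
split=> [|a u v _ /= ux vx]; first by rewrite /= scale0r.
by rewrite scalerDl -[a *: u]/(a * u) -scalerA ux vx scaler0 addr0.
Qed.

Lemma ideal_generated_annihilate (R : comPzRingType) (V : lmodType R)
    (X : set R) (x : V) :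
  (forall a, X a -> a *: x = 0) ->
  forall r, ideal_generated X r -> r *: x = 0.
Proof.
by move=> Xx r; apply: (smallest_sub (ideal_annihilator x)).
Qed.

(** Finitely many generators of the ideal generated by [X] suffice, and the product of their
    individual multipliers serves for all of them. *)
Lemma noetherian_common_multiplier (R : comPzRingType) (V : lmodType R)
    (S X : set R) (x : V) :
  noetherian R -> S 1 -> (forall a b, S a -> S b -> S (a * b)) ->
  (forall a, X a -> exists2 c, S c & c *: (a *: x) = 0) ->
  exists2 c, S c & forall a, X a -> a *: (c *: x) = 0.
Proof.
move=> noeth S1 SM Xx.
(* [K] is the annihilator of the image of [x] in the localization of [V] at [S]. The generators [s]
   need not lie in [X], so the hypothesis on [X] has to be extended to an ideal. *)
pose K : set R := [set r | exists2 c, S c & c *: (r *: x) = 0].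
have idK : ideal K.
  split=> [|a u v _ [c Sc cu] [e Se ev]].
    by exists 1; rewrite // scale0r scaler0.
  exists (c * e); first exact: SM.
  rewrite scalerA in cu; rewrite scalerA in ev.
  rewrite -[a *: u]/(a * u) scalerA.
  rewrite (_ : _ * _ = e * a * (c * u) + c * (e * v)); last by ring.
  by rewrite scalerDl -(scalerA (e * a)) -(scalerA c (e * v)) cu ev !scaler0 addr0.
have idX : ideal (ideal_generated X).
  split=> [J [[J0 _]]//|a u v _ Xu Xv J JX].
  have [[_ JD] _] := JX.
  by apply: JD => //; [apply: Xu|apply: Xv].
have [s sX] := noeth _ idX.
have sK (r : R) : r \in s -> K r.
  move=> rs; apply: (smallest_sub idK Xx).
  rewrite -/(ideal_generated X) sX.
  exact: sub_gen_smallest.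
have [c Sc cs] : exists2 c, S c & forall r, r \in s -> r *: (c *: x) = 0.
  elim: s {sX} sK => [|r s IHs] sK; first by exists 1.
  have [e Se es] : exists2 c, S c & forall r, r \in s -> r *: (c *: x) = 0.
    by apply: IHs => q qs; apply: sK; rewrite in_cons qs orbT.
  have [c Sc cr] := sK r (mem_head _ _).
  exists (c * e); first exact: SM.
  move=> q; rewrite in_cons => /predU1P[->|/es qx].
    by rewrite scalerA (_ : r * (c * e) = e * (c * r)) -?scalerA ?cr ?scaler0//; ring.
  by rewrite scalerA mulrCA -!scalerA qx scaler0.
exists c => // a Xa.
have : ideal_generated X a by apply: sub_gen_smallest.
rewrite sX; exact: (smallest_sub (ideal_annihilator (c *: x))).
Qed.

(** * Multidegrees and stabilization of monotone families *)

Definition unit_degree (d : nat) (i : 'I_d) : 'I_d -> nat := fun j => (j == i)%N.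

Lemma degree_one_unit (d : nat) (n : 'I_d -> nat) (i : 'I_d) :
  (\sum_j n j = 1)%N -> n i <> 0%N -> n = unit_degree i.
Proof.
move=> n1 ni; apply/funext => j; rewrite /unit_degree.
have := n1; rewrite (bigD1 i)//=.
case nik: (n i) ni => [|k] // _; rewrite addSn => -[] /eqP.
rewrite addn_eq0 sum_nat_eq0 => /andP[/eqP k0 /forallP n0].
by case: eqP => [->|/eqP ji]; [rewrite nik k0|apply/eqP; exact: (implyP (n0 j))].
Qed.

(** An element of [E] either lies in no [F n] beyond [b], or lies in some [F m] and then, by
    monotonicity, in every later one. The join of these finitely many [m] with [b] is the bound. *)
Lemma finite_set_common_bound (d : nat) (T : choiceType) (E : set T)
    (F : ('I_d -> int) -> set T) (b : 'I_d -> int) :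
  finite_set E ->
  (forall n m, (b <= n)%O -> (n <= m)%O -> F n `<=` F m) ->
  exists2 k, (b <= k)%O & forall n, (b <= n)%O -> E `&` F n `<=` F k.
Proof.
move=> /finite_seqP[s ->] Fmono.
elim: s => [|p s [k bk IHs]]; first by exists b => // n _ p [].
have [[m bm pm]|nom] := pselect (exists2 m, (b <= m)%O & F m p); last first.
  exists k => // n bn q [/=]; rewrite in_cons => /predU1P[->|qs] Fq.
    by case: nom; exists n.
  by apply: (IHs n bn); split.
exists (fun i => Num.max (k i) (m i)).
  by apply/lefP => i; rewrite le_max (lefP _ _ bk).
move=> n bn q [/=]; rewrite in_cons => /predU1P[->|qs] Fq.
  by apply: Fmono pm => //; apply/lefP => i; rewrite le_max lexx orbT.
apply: (Fmono k) => //; first by apply/lefP => i; rewrite le_max lexx.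
by apply: (IHs n bn); split.
Qed.

(** * Associated primes of the graded pieces *)

Section QuasiFinite.
Variables (d : nat) (R : comPzRingType) (Rg : ('I_d -> nat) -> set R).
Variables (M : lmodType R) (Mg : ('I_d -> int) -> set M).

Let A := Rg (fun=> 0%N).
Let R0 (i : 'I_d) := homogeneous_span Rg [set n | n i = 0%N].

Hypothesis stdR : standard_graded_noetherian Rg.
Hypothesis gradedM : graded_module Rg Mg.

Let gradedR : graded_ring Rg. Proof. by case: stdR. Qed.

Let one_A : A 1. Proof. by case: gradedR. Qed.

Let mul_A (a b : R) : A a -> A b -> A (a * b).
Proof. by case: gradedR => _ _ mulR Aa Ab; apply: (mulR _ _ _ _ Aa Ab). Qed.

Let R0_mul (i : 'I_d) (u v : R) : R0 i u -> R0 i v -> R0 i (u * v).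
Proof.
have [R00 R0B] := homogeneous_span_zmod Rg [set n | n i = 0%N].
move=> + R0v; move: u; apply: homogeneous_span_ind => [|u w|n ni u Ru] /=.
- by rewrite mul0r.
- by rewrite mulrBl; apply: R0B.
move: v R0v; apply: homogeneous_span_ind => [|v w|m mi v Rv] /=.
- by rewrite mulr0.
- by rewrite mulrBr; apply: R0B.
have [_ _ mulR] := gradedR.
by apply: homogeneous_span_sub (mulR _ _ _ _ Ru Rv); rewrite /= ni mi.
Qed.

(** The [r] for which such a [v] exists form a subring. It contains [A] and every form of total
    degree one: one of degree e_i kills [x], and any other already lies in [R0 i]. *)
Lemma scale_eq_constant_degree (i : 'I_d) (x : M) :
  (forall a, Rg (unit_degree i) a -> a *: x = 0) ->
  forall r, exists2 v, R0 i v & r *: x = v *: x.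
Proof.
move=> ax r.
have [_ _ genR] := stdR.
have [R00 R0B] := homogeneous_span_zmod Rg [set n | n i = 0%N].
have : [set: R] r by [].
rewrite -genR; move: r; apply: smallest_sub.
  split; rewrite ?inE /=.
  - by exists 1 => //; apply: homogeneous_span_sub one_A.
  - move=> u v; rewrite !inE => -[u' R0u ux] [v' R0v vx].
    by exists (u' - v'); [apply: R0B|rewrite !scalerBl ux vx].
  - move=> u v; rewrite !inE => -[u' R0u ux] [v' R0v vx].
    exists (u' * v'); first exact: R0_mul.
    by rewrite -(scalerA u) vx scalerA [u * _]mulrC -(scalerA v') ux scalerA mulrC.
move=> r [Ar|[n /= n1 Rr]].
  by exists r => //; apply: homogeneous_span_sub Ar.
have [ni|ni] := pselect (n i = 0%N).
  by exists r => //; apply: homogeneous_span_sub Rr.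
exists 0 => //; rewrite scale0r; apply: ax.
by rewrite -(degree_one_unit n1 ni).
Qed.

(** No factorization of forms is needed, only a comparison of degrees. For [a] in R_(1,...,1),
    [a *: x] has [i]-th degree [n i + 1], yet it equals some [v *: x] with [v] in [R0 i], whose
    components have [i]-th degree [n i]. Hence both vanish. *)
Lemma irrelevant_annihilate (i : 'I_d) (n : 'I_d -> int) (x : M) :
  Mg n x -> (forall a, Rg (unit_degree i) a -> a *: x = 0) ->
  local_cohomology0 Rg x.
Proof.
move=> Mx ax.
have [dM scaleM] := gradedM.
(* The first power unfolds to the product of the irrelevant ideal with the whole ring, hence the
   extra factor [c]. *)
exists 1%N => // r; apply: ideal_generated_annihilate => _ [a Ia [c _ <-]].
rewrite mulrC -scalerA (_ : a *: x = 0) ?scaler0//.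
move: a Ia; apply: ideal_generated_annihilate => a Ra.
have [v R0v avx] := scale_eq_constant_degree ax a.
pose P := [set m : 'I_d -> int | m i = n i].
have [P0 PB] := homogeneous_span_zmod Mg P.
apply: (homogeneous_span_eq0 dM (P := P) _ (scaleM _ _ _ _ Ra Mx)).
  by rewrite /P /= -[X in _ = X]add0r => /addIr.
rewrite avx; move: v R0v {avx}; apply: homogeneous_span_ind => [|u v|m mi v Rv] /=.
- by rewrite scale0r.
- by rewrite scalerBl; apply: PB.
by apply: homogeneous_span_sub (scaleM _ _ _ _ Rv Mx); rewrite /P /= mi add0r.
Qed.

Lemma Ass_shift (n : 'I_d -> int) (i : 'I_d) :
  local_cohomology0 Rg (M := M) `&` Mg n = [set 0] ->
  Ass A (Mg n) `<=` Ass A (Mg (fun j => (unit_degree i j)%:Z + n j)).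
Proof.
move=> H0 P [primeP [x Mx Px]].
have [_ noeth _] := stdR.
have [dM scaleM] := gradedM.
have scaleA (c : R) : A c -> Mg n (c *: x).
  move=> Ac; have := scaleM _ _ _ _ Ac Mx.
  by rewrite (_ : (fun i => _) = n)//; apply/funext => j; rewrite add0r.
suff [a Ra ann_a] : exists2 a, Rg (unit_degree i) a & P = annihilator A (a *: x).
  by split=> //; exists (a *: x) => //; apply: scaleM.
apply: contrapT => no_a.
have [_ _ P1 PM] := primeP.
have [c [Ac nPc] cx] : exists2 c, A c /\ ~ P c
    & forall a, Rg (unit_degree i) a -> a *: (c *: x) = 0.
  (* The multiplicative set is the complement of [P] in [A], closed under products because [P] is
     prime. *)
  apply: noetherian_common_multiplier => // [a b [Aa nPa] [Ab nPb]|a Ra].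
    by split=> [|/(PM _ _ Aa Ab)[]//]; apply: mul_A.
  (* [P] always annihilates [a *: x]; if no element of [A] outside [P] does, then [P] is its
     annihilator, against [no_a]. *)
  apply: contrapT => noc; apply: no_a; exists a => //.
  rewrite Px; apply/seteqP; split=> c [Ac cax]; split=> //.
    by rewrite scalerA mulrC -scalerA cax scaler0.
  by apply: contrapT => ncx; apply: noc; exists c => //; split=> //; rewrite Px => -[].
(* [c *: x] stays in degree [n] and is torsion, so it is zero; this puts [c] in [P]. *)
apply: nPc; rewrite Px; split=> //.
have : (local_cohomology0 Rg (M := M) `&` Mg n) (c *: x).
  by split; [apply: (@irrelevant_annihilate i n)|]; do ?apply: scaleA.
by rewrite H0.
Qed.

(** A path of unit steps leads from [n] to [m] and never leaves the region above [b]. The induction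
    is on its length, with the starting point [n] varying. *)
Lemma Ass_mono (b : 'I_d -> int) :
  (forall n, (b <= n)%O -> local_cohomology0 Rg (M := M) `&` Mg n = [set 0]) ->
  forall n m, (b <= n)%O -> (n <= m)%O -> Ass A (Mg n) `<=` Ass A (Mg m).
Proof.
move=> H0 n m bn nm.
pose k i := `|m i - n i|%N.
have mk : m = fun i => (k i)%:Z + n i.
  apply/funext => i; rewrite /k gez0_abs ?subrK// subr_ge0.
  exact: (lefP _ _ nm).
rewrite mk; move: k {nm mk} => k.
have [N kN] : exists N, (\sum_i k i = N)%N by eexists.
elim: N k kN n bn => [|N IHN] k kN n bn.
  move/eqP: kN; rewrite sum_nat_eq0 => /forallP k0.
  rewrite (_ : (fun i => _) = n)//; apply/funext => i.
  by rewrite (eqP (implyP (k0 i) isT)) add0r.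
have [i ki] : exists i, (0 < k i)%N.
  apply: contrapT => nk; have : (\sum_i k i = 0)%N; last by rewrite kN.
  apply: big1 => i _; apply/eqP; rewrite -leqn0 leqNgt; apply/negP => ki.
  by apply: nk; exists i.
pose k' j := (k j - unit_degree i j)%N.
have kk' j : k j = (k' j + unit_degree i j)%N.
  by rewrite subnK// /unit_degree; case: eqP => // ->.
have sum_k' : (\sum_j k' j)%N = N.
  apply/eq_add_S; rewrite -kN (eq_bigr _ (fun j _ => kk' j)) big_split /= -addn1.
  by congr addn; rewrite /unit_degree (bigD1 i)//= eqxx big1// => j /negPf ->.
apply: subset_trans (Ass_shift i (H0 n bn)) _.
rewrite (_ : (fun j => (k j)%:Z + n j) =
    fun j => (k' j)%:Z + ((unit_degree i j)%:Z + n j)); last first.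
  by apply/funext => j; rewrite kk' PoszD addrA.
apply: IHN => //; apply/lefP => j.
by rewrite (le_trans (lefP _ _ bn j))// lerDr.
Qed.

End QuasiFinite.

Theorem theorem2p7 (d : nat) (R : comPzRingType) (Rg : ('I_d -> nat) -> set R)
    (M : lmodType R) (Mg : ('I_d -> int) -> set M) :
  let A := Rg (fun=> 0%N) in
  standard_graded_noetherian Rg ->
  quasi_finite Rg Mg ->
  (exists b : 'I_d -> int, forall n m : 'I_d -> int,
     (b <= n)%O -> (n <= m)%O -> Ass A (Mg n) `<=` Ass A (Mg m)) /\
  (finite_set (Ass A [set: M]) ->
   exists k : 'I_d -> int, forall n : 'I_d -> int,
     (k <= n)%O -> Ass A (Mg n) = Ass A (Mg k)).
Proof.
move=> A stdR [[gradedM _ _] [b H0]].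
have mono := Ass_mono stdR gradedM H0.
split=> [|finM]; first by exists b.
(* The finite set is Ass of all of [M], which contains every [Ass A (Mg n)] since the same witness
   [x] serves. *)
have [k bk bound] := finite_set_common_bound finM mono.
exists k => n kn; apply/seteqP; split; last exact: mono.
move=> P AssP; apply: (bound n (le_trans bk kn)); split=> //.
by have [primeP [x _ Px]] := AssP; split=> //; exists x.
Qed.
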